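(* Let $s=(s_0,s_1,s_2,\dots)$ be an integer sequence with $s_n\ge2$ for all $n\ge1$. For $n\ge0$ let \[ g_{n,s}=\begin{pmatrix} a_{n,s}&b_{n,s}\\ c_{n,s}&d_{n,s}\end{pmatrix}=\mathsf{V}(s_0)\mathsf{V}(s_1)\cdots\mathsf{V}(s_n),\qquad \mathsf{V}(m)=\begin{pmatrix} m&-1\\ 1&0\end{pmatrix}, \] and define $R_n(s)=\frac{a_{n,s}}{c_{n,s}}$, $L_n(s)=\frac{a_{n,s}+b_{n,s}}{c_{n,s}+d_{n,s}}$ and $A_n(s)=(c_{n,s}+d_{n,s})c_{n,s}$. Then for every $n\ge0$, \[ c_{n+1,s}>c_{n,s}>0,\qquad c_{n+1,s}+d_{n+1,s}\ge c_{n,s}+d_{n,s}>0,\qquad d_{n,s}\le0, \] (so in particular $R_n(s),L_n(s)$ are well defined) and \[ R_n(s)-L_n(s)=\frac1{A_n(s)}. \] Moreover, $(A_n(s))_{n\ge0}$ is a strictly increasing sequence of positive integers, $(R_n(s))_{n\ge0}$ is a strictly decreasing sequence of rationals bounded from below, and $(L_n(s))_{n\ge0}$ is a (non-strictly) increasing sequence of rationals bounded from above.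
   Context: $R_n(s)$, $L_n(s)$, $A_n(s)$ are called the $n$-th right convergent, left convergent, and accuracy of $s$, respectively. *)

(* Defs.v *)
From mathcomp Require Import all_boot all_order all_algebra.

Set Implicit Arguments.
Unset Strict Implicit.
Unset Printing Implicit Defensive.

Import Order.TTheory GRing.Theory Num.Theory.
Local Open Scope ring_scope.

Definition V (m : int) : 'M[int]_2 :=
  \matrix_(i < 2, j < 2)
    nth 0 (nth [::] [:: [:: m; -1];
                        [:: 1;  0]] i) j.

(* The product is taken in the noncommutative ring 'M[int]_2, from left to
   right, and has n + 1 factors V (s 0), ..., V (s n). *)
Definition g (s : nat -> int) (n : nat) : 'M[int]_2 :=
  \prod_(i < n.+1) V (s i).

(* The indices 0 and 1 below are the two elements of 'I_2. *)
Definition ga (s : nat -> int) (n : nat) : int := g s n 0 0.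
Definition gb (s : nat -> int) (n : nat) : int := g s n 0 1.
Definition gc (s : nat -> int) (n : nat) : int := g s n 1 0.
Definition gd (s : nat -> int) (n : nat) : int := g s n 1 1.

Definition right_convergent (s : nat -> int) (n : nat) : rat :=
  (ga s n)%:Q / (gc s n)%:Q.

Definition left_convergent (s : nat -> int) (n : nat) : rat :=
  (ga s n + gb s n)%:Q / (gc s n + gd s n)%:Q.

Definition accuracy (s : nat -> int) (n : nat) : int :=
  (gc s n + gd s n) * gc s n.

(* Main.v *)
(** Writing m = s (n+1), the recurrence a' = a m + b, b' = -a, c' = c m + d,
    d' = -c preserves the determinant 1, so that R' - R = -1/(c c'),
    L' - L = (m - 2)/((c + d)(c' + d')) and R - L = 1/A.  Signs follow from
    m >= 2, and the bounds from L 0 <= L n < R n <= R 0. *)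
Require Import Defs.
From mathcomp Require Import all_boot all_order all_algebra.
From mathcomp Require Import ring lra.

Set Implicit Arguments.
Unset Strict Implicit.
Unset Printing Implicit Defensive.

Import Order.TTheory GRing.Theory Num.Theory.
Local Open Scope ring_scope.

Lemma mulmxV (M : 'M[int]_2) (m : int) (i : 'I_2) :
  (M * V m) i 0 = M i 0 * m + M i 1 /\ (M * V m) i 1 = - M i 0.
Proof.
(* Unfolding the sum writes the second column index as [lift ord0 ord0], which matches [1] only by
   value, hence [val_inj]. *)
by split; rewrite !mxE big_ord_recl big_ord1 !mxE /= ?mulr1 ?mulr0 ?addr0
  ?mulrN1 //; congr (_ + M i _); apply: val_inj.
Qed.

Lemma g0 s : g s 0 = V (s 0).
Proof. by rewrite /g big_ord1. Qed.

Lemma gS s n : g s n.+1 = g s n * V (s n.+1).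
Proof. by rewrite /g big_ord_recr. Qed.

Lemma gaS s n : ga s n.+1 = ga s n * s n.+1 + gb s n.
Proof. by rewrite /ga gS (mulmxV _ _ _).1. Qed.

Lemma gbS s n : gb s n.+1 = - ga s n.
Proof. by rewrite /gb gS (mulmxV _ _ _).2. Qed.

Lemma gcS s n : gc s n.+1 = gc s n * s n.+1 + gd s n.
Proof. by rewrite /gc gS (mulmxV _ _ _).1. Qed.

Lemma gdS s n : gd s n.+1 = - gc s n.
Proof. by rewrite /gd gS (mulmxV _ _ _).2. Qed.

Lemma g_det s n : ga s n * gd s n - gb s n * gc s n = 1.
Proof.
elim: n => [|n IH]; last by rewrite gaS gbS gcS gdS -IH; ring.
by rewrite /ga /gb /gc /gd g0 !mxE /=; ring.
Qed.

Lemma g_detQ s n :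
  (ga s n)%:Q * (gd s n)%:Q - (gb s n)%:Q * (gc s n)%:Q = 1.
Proof. by rewrite -!intrM -intrB g_det. Qed.

(** Over the common denominator, the numerator is a (c + d) - (a + b) c = a d - b c. *)
Lemma right_sub_left s n : gc s n != 0 -> gc s n + gd s n != 0 ->
  right_convergent s n - left_convergent s n = 1 / (accuracy s n)%:Q.
Proof.
rewrite -!(intr_eq0 rat) intrD => c0 cd0.
rewrite /right_convergent /left_convergent /accuracy intrM !intrD.
(* Once the numerator 1 is replaced by the determinant, the identity holds for arbitrary entries, so
   [field] applies. *)
by rewrite -[X in _ = X / _](g_detQ s n); field; rewrite c0 cd0.
Qed.

(** The multiplier m cancels: a (c m + d) - (a m + b) c = a d - b c. *)
Lemma right_convergentS s n : gc s n != 0 -> gc s n.+1 != 0 ->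
  right_convergent s n - right_convergent s n.+1 =
  1 / (gc s n * gc s n.+1)%:Q.
Proof.
rewrite -!(intr_eq0 rat) => c0; rewrite /right_convergent gaS gcS.
rewrite !intrM !intrD !intrM => c1.
by rewrite -[X in _ = X / _](g_detQ s n); field; rewrite c0 c1.
Qed.

(** Since a' + b' = (a + b) + (m - 2) a and c' + d' = (c + d) + (m - 2) c, the cross difference is
    (m - 2) (a d - b c). *)
Lemma left_convergentS s n :
  gc s n + gd s n != 0 -> gc s n.+1 + gd s n.+1 != 0 ->
  left_convergent s n.+1 - left_convergent s n =
  (s n.+1 - 2)%:Q / ((gc s n + gd s n) * (gc s n.+1 + gd s n.+1))%:Q.
Proof.
rewrite -!(intr_eq0 rat) /left_convergent gaS gbS gcS gdS.
rewrite intrB !intrM !intrD !mulrNz !intrM => c0 c1.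
rewrite -[X in _ = X / _]mulr1 -[X in _ = (_ * X) / _](g_detQ s n).
by field; rewrite c0 c1.
Qed.

(** The bottom row starts as (1, 0) whatever [s 0] is; then c' = (c + d) + (m - 1) c, c' + d' = (c +
    d) + (m - 2) c and d' = -c. *)
Lemma g_bounds s : (forall n, (1 <= n)%N -> 2 <= s n) ->
  forall n, [/\ 0 < gc s n, 0 < gc s n + gd s n & gd s n <= 0].
Proof.
move=> hs; elim=> [|n [c0 cd0 d0]]; first by rewrite /gc /gd g0 !mxE.
have m2 := hs n.+1 isT.
by rewrite gcS gdS; split; nra.
Qed.

Theorem theorem1 (s : nat -> int) (hs : forall n : nat, (1 <= n)%N -> 2 <= s n) :
  (forall n : nat,
      (gc s n < gc s n.+1 /\ 0 < gc s n) /\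
      (gc s n + gd s n <= gc s n.+1 + gd s n.+1 /\ 0 < gc s n + gd s n) /\
      gd s n <= 0 /\
      right_convergent s n - left_convergent s n = 1 / (accuracy s n)%:Q) /\
  ((forall n : nat, 0 < accuracy s n) /\
   (forall m n : nat, (m < n)%N -> accuracy s m < accuracy s n)) /\
  ((forall m n : nat, (m < n)%N -> right_convergent s n < right_convergent s m) /\
   (exists B : rat, forall n : nat, B <= right_convergent s n)) /\
  ((forall m n : nat, (m <= n)%N -> left_convergent s m <= left_convergent s n) /\
   (exists B : rat, forall n : nat, left_convergent s n <= B)).
Proof.
have bnd := g_bounds hs.
have c0 n : 0 < gc s n by have [] := bnd n.
have cd0 n : 0 < gc s n + gd s n by have [] := bnd n.
have cS n : gc s n < gc s n.+1.
  (* Here c' - c = (m - 2) c + (c + d). *)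
  by have m2 := hs n.+1 isT; rewrite gcS; move: (c0 n) (cd0 n); nra.
have cdS n : gc s n + gd s n <= gc s n.+1 + gd s n.+1.
  by have m2 := hs n.+1 isT; rewrite gcS gdS; move: (c0 n); nra.
have A0 n : 0 < accuracy s n by rewrite mulr_gt0.
have Aincr : {homo accuracy s : m n / (m < n)%N >-> m < n}.
  apply: homo_ltn => [y x z|n]; first exact: lt_trans.
  (* One factor at a time: (c + d) c <= (c' + d') c < (c' + d') c'. *)
  by rewrite (le_lt_trans (ler_wpM2r (ltW (c0 n)) (cdS n))) // ltr_pM2l.
have RL n : right_convergent s n - left_convergent s n = 1 / (accuracy s n)%:Q.
  by rewrite right_sub_left ?gt_eqF.
have ltLR n : left_convergent s n < right_convergent s n.
  by rewrite -subr_gt0 RL divr_gt0 // ltr0z.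
have Rdecr : {homo right_convergent s : m n / (m < n)%N >-> n < m}.
  apply: homo_ltn => [y x z xy yz|n]; first exact: lt_trans yz xy.
  by rewrite -subr_gt0 right_convergentS ?gt_eqF // divr_gt0 // ltr0z mulr_gt0.
have Lincr : {homo left_convergent s : m n / (m <= n)%N >-> m <= n}.
  apply: homo_leq => [//|y x z|n]; first exact: le_trans.
  rewrite -subr_ge0 left_convergentS ?gt_eqF //.
  by rewrite divr_ge0 // ler0z ?subr_ge0 ?hs // mulr_ge0 // ltW.
split; first by move=> n; have [_ _ d0] := bnd n.
split; first by [].
split; split=> //.
  by exists (left_convergent s 0) => n; rewrite (le_trans (Lincr 0 n _)) // ltW.
(* Index 0 is separate because [Rdecr] is strict and compares only distinct indices. *)
exists (right_convergent s 0) => -[|n]; first exact: ltW.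
by rewrite ltW // (lt_trans (ltLR _)) // Rdecr.
Qed.
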